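(* Let $n$ be a positive integer and let $T=(\tau_0,\tau_1,\tau_2,\ldots)$ be a list of truncations of $\Phi(n)=([n]^0,[n]^1,[n]^2,\ldots)$, i.e. $\tau_d$ is a truncation of $[n]^d$ for each $d\ge 0$. Then the following are equivalent: i) $T=(\tau_0,\tau_1,\tau_2,\ldots)$ is a coherent fractal growth; ii) $(|\tau_0|,|\tau_1|,|\tau_2|,\ldots)$ is an $O$-sequence.
   Context: **Expansions of sequences.** For a positive integer $a$ let $[a]=(1,2,\ldots,a)$. For a sequence of positive integers $\sigma=(s_1,s_2,\ldots)$ let $[\sigma]$ be the concatenation of $[s_1],[s_2],\ldots$ in this order (the expansion of the empty sequence is empty). For a positive integer $a$ put $[a]^0=(a)$ and $[a]^d=[[a]^{d-1}]$ for $d\ge 1$. For example $[3]^1=(1,2,3)$, $[3]^2=(1,1,2,1,2,3)$. For a finite sequence $\sigma$, $|\sigma|$ is its number of entries. **Truncations.** A (possibly empty) sequence $\tau$ is a truncation of $\sigma$ if $|\tau|\le|\sigma|$ and $\tau(j)=\sigma(j)$ for all $j\le|\tau|$. **Coherent fractal growth.** $T=(\tau_0,\tau_1,\tau_2,\ldots)$ is a coherent fractal growth if $\tau_0=(n)$ and $\tau_j$ is a truncation of $[\tau_{j-1}]$ for each $j\ge1$. **$O$-sequences.** For integers $h,i>0$, $h$ has a unique $i$-binomial expansion $h=\binom{m_i}{i}+\binom{m_{i-1}}{i-1}+\cdots+\binom{m_j}{j}$ with $m_i>m_{i-1}>\cdots>m_j\ge j\ge1$. Put $h^{\langle i\rangle}=\binom{m_i+1}{i+1}+\binom{m_{i-1}+1}{i}+\cdots+\binom{m_j+1}{j+1}$,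 and $0^{\langle i\rangle}=0$. A sequence of non-negative integers $(h_0,h_1,h_2,\ldots)$ is an $O$-sequence if $h_0=1$ and $h_{i+1}\le h_i^{\langle i\rangle}$ for all $i>0$. *)

(* Defs.v *)
From mathcomp Require Import all_boot zify.

Set Implicit Arguments.
Unset Strict Implicit.
Unset Printing Implicit Defensive.

Definition expansion (s : seq nat) : seq nat := flatten [seq iota 1 a | a <- s].

(* [expansion_pow a d] is [a]^d; in particular [a]^1 = [(a)] = (1, ..., a). *)
Definition expansion_pow (a d : nat) : seq nat := iter d expansion [:: a].

(* Entries are indexed from 0. *)
Definition truncation (t s : seq nat) : Prop :=
  size t <= size s /\ forall j, j < size t -> nth 0 t j = nth 0 s j.

Lemma truncationP (t s : seq nat) : truncation t s <-> prefix t s.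
Proof.
rewrite prefixE; split=> [[le_ts eq_ts] | /eqP def_t].
  apply/eqP/(@eq_from_nth _ 0); rewrite size_takel // => j lt_jt.
  by rewrite nth_take // eq_ts.
have le_ts: size t <= size s by rewrite -def_t size_take_min geq_minr.
by split=> // j lt_jt; rewrite -[in LHS]def_t nth_take.
Qed.

Definition coherent_fractal_growth (n : nat) (T : nat -> seq nat) : Prop :=
  T 0 = [:: n] /\ forall j, 0 < j -> truncation (T j) (expansion (T j.-1)).

(* The sequence m_i > ... > m_j is stored as the list m = [:: m_i; ...; m_j],
   so m_(i - k) is [nth 0 m k] and j = i + 1 - size m; the condition j >= 1 is
   [size m <= i], and m_j >= j is the bound on [last 0 m]. *)
Definition binomial_expansion (h i : nat) (m : seq nat) : bool :=
  [&& 0 < size m <= i, sorted gtn m, i.+1 - size m <= last 0 m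
    & h == \sum_(k < size m) 'C(nth 0 m k, i - k)].

Lemma binomial_expansion1 h i x :
  binomial_expansion h i [:: x] = [&& 0 < i, i <= x & h == 'C(x, i)].
Proof. by rewrite /binomial_expansion /= subSS subn0 big_ord1 subn0. Qed.

Lemma binomial_expansion_cons h i x y m :
  binomial_expansion h i.+1 [:: x, y & m] =
  [&& y < x, 'C(x, i.+1) <= h
    & binomial_expansion (h - 'C(x, i.+1)) i (y :: m)].
Proof.
rewrite /binomial_expansion /= ltnS subSS big_ord_recl /= subn0.
under eq_bigr => k _ do rewrite /bump /= add1n subSS.
set S := \sum_(_ < _) _; set b := 'C(x, i.+1).
case: (y < x); rewrite ?andbF //=.
have ->: (h == b + S) = (b <= h) && (h - b == S) by lia.
by do !bool_congr.
Qed.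

Lemma binomial_expansion_lt h i x m :
  binomial_expansion h i (x :: m) -> 'C(x, i) <= h < 'C(x.+1, i).
Proof.
elim: m i h x => [|y m IHm] [|i] h x //.
  rewrite binomial_expansion1 => /and3P[_ le_ix /eqP->].
  rewrite leqnn binS -[ltnLHS]addn0 ltn_add2l bin_gt0; lia.
rewrite binomial_expansion_cons => /and3P[lt_yx le_b /IHm/andP[_ lt_h]].
rewrite le_b binS /=.
have: 'C(y.+1, i) <= 'C(x, i) by apply: leq_bin2l.
lia.
Qed.

Lemma binomial_expansion_pos h i m : binomial_expansion h i m -> 0 < h.
Proof.
elim: m i h => [|x [|y m] IHm] [|i] h //.
  by rewrite binomial_expansion1 => /and3P[_ le_ix /eqP->]; rewrite bin_gt0.
by rewrite binomial_expansion_cons => /and3P[_ _ /IHm]; lia.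
Qed.

Lemma binomial_expansion_uniq h i m1 m2 :
  binomial_expansion h i m1 -> binomial_expansion h i m2 -> m1 = m2.
Proof.
elim: m1 i h m2 => [|x1 m1 IHm] [|i] h [|x2 m2] // E1 E2.
have Ex: x1 = x2.
  have /andP[l1 u1] := binomial_expansion_lt E1.
  have /andP[l2 u2] := binomial_expansion_lt E2.
  case: (ltngtP x1 x2) => // lt_x.
    by have := @leq_bin2l _ _ i.+1 lt_x; lia.
  by have := @leq_bin2l _ _ i.+1 lt_x; lia.
rewrite -{x2}Ex in E2 *; congr cons.
case: m1 m2 => [|y1 m1] [|y2 m2] // in IHm E1 E2 *.
- move: E1 E2; rewrite binomial_expansion1 binomial_expansion_cons.
  by move=> /and3P[_ _ /eqP->] /and3P[_ _ /binomial_expansion_pos]; lia.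
- move: E2 E1; rewrite binomial_expansion1 binomial_expansion_cons.
  by move=> /and3P[_ _ /eqP->] /and3P[_ _ /binomial_expansion_pos]; lia.
move: E1 E2; rewrite !binomial_expansion_cons => /and3P[_ _ E1] /and3P[_ _ E2].
exact: IHm E1 E2.
Qed.

Lemma binomial_expansion_exists h i :
  0 < h -> 0 < i -> exists m, binomial_expansion h i m.
Proof.
move=> h_gt0 i_gt0.
have ltM: h < 'C(h + i, i).
  elim: i i_gt0 => // -[_ _|i IHi _]; first by rewrite addn1 bin1.
  by rewrite addnS binS; have := IHi isT; lia.
suff [x [m [_ Em]]]: exists x m, x < h + i /\ binomial_expansion h i (x :: m).
  by exists (x :: m).
move: (h + i) ltM => M; elim: i h M i_gt0 h_gt0 => // i IHi h M _ h_gt0 ltM.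
have exx: exists x, 'C(x, i.+1) <= h by exists 0; rewrite bin0n.
have ubx x: 'C(x, i.+1) <= h -> x <= M.
  move=> le_x; case: leqP => // lt_Mx.
  by have := @leq_bin2l _ _ i.+1 (ltnW lt_Mx); lia.
have [x le_x max_x] := ex_maxnP exx ubx.
have le_ix: i.+1 <= x by apply: max_x; rewrite binn.
have lt_h: h < 'C(x, i.+1) + 'C(x, i).
  by rewrite -binS ltnNge; apply/negP => /max_x; rewrite ltnn.
have lt_xM: x < M.
  by rewrite ltnNge; apply/negP => /(@leq_bin2l _ _ i.+1); lia.
have [eq_h | ne_h] := eqVneq h 'C(x, i.+1).
  by exists x, [::]; rewrite binomial_expansion1 le_ix eq_h eqxx.
case: i => [|i] in IHi le_x max_x le_ix lt_h ltM lt_xM ne_h exx ubx *.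
  by rewrite bin0 bin1 in lt_h le_x ne_h; lia.
have [||y [m [lt_yx Em]]] := IHi (h - 'C(x, i.+2)) x isT; try lia.
by exists x, (y :: m); rewrite binomial_expansion_cons lt_yx le_x Em.
Qed.

Lemma binomial_expansion_total h i :
  exists m, (0 < h) && (0 < i) ==> binomial_expansion h i m.
Proof.
have [/andP[h_gt0 i_gt0] | _] := boolP ((0 < h) && (0 < i)); last by exists [::].
by have [m Em] := binomial_expansion_exists h_gt0 i_gt0; exists m.
Qed.

(* The value is meaningful for 0 < i only. *)
Definition macaulay_pow (h i : nat) : nat :=
  if h == 0 then 0 else
  let m := xchoose (binomial_expansion_total h i) in
  \sum_(k < size m) 'C((nth 0 m k).+1, (i - k).+1).

Lemma macaulay_powE h i m : binomial_expansion h i m ->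
  macaulay_pow h i = \sum_(k < size m) 'C((nth 0 m k).+1, (i - k).+1).
Proof.
move=> Em; have h_gt0 := binomial_expansion_pos Em.
have i_gt0: 0 < i by case/and4P: Em; lia.
rewrite /macaulay_pow (gtn_eqF h_gt0).
move: (xchoose _) (xchooseP (binomial_expansion_total h i)) => m'.
by rewrite h_gt0 i_gt0 => /binomial_expansion_uniq/(_ Em)->.
Qed.

Definition O_sequence (h : nat -> nat) : Prop :=
  h 0 = 1 /\ forall i, 0 < i -> h i.+1 <= macaulay_pow (h i) i.

(* Main.v *)
(* By induction on i, [a+1]^(i+1) = [a]^(i+1) [a+1]^i, so |[a+1]^i| = C(a+i, i)
   and the expansion of a truncation of [n]^i is a truncation of [n]^(i+1).
   Cutting [n]^i after h entries thus peels off the blocks [m_i - i + 1]^i,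
   [m_(i-1) - i + 2]^(i-1), ... given by the i-binomial expansion of h; the
   entries of [a]^i sum up to |[a]^(i+1)|, so the first h entries of [n]^i sum
   up to h^<i>, which is the length of the expansion of this truncation. *)
Require Import Defs.
From mathcomp Require Import all_boot zify.

Lemma expansion_cat s t : expansion (s ++ t) = expansion s ++ expansion t.
Proof. by rewrite /expansion map_cat flatten_cat. Qed.

Lemma size_expansion s : size (expansion s) = sumn s.
Proof.
rewrite size_flatten /shape -map_comp; congr sumn.
by rewrite -[RHS]map_id; apply: eq_map => a /=; rewrite size_iota.
Qed.

Lemma prefix_expansion s t : prefix s t -> prefix (expansion s) (expansion t).
Proof. by case/prefixP=> u ->; rewrite expansion_cat prefix_prefix. Qed.

Lemma iter_expansion_cat d s t :
  iter d expansion (s ++ t) = iter d expansion s ++ iter d expansion t.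
Proof. by elim: d => //= d ->; rewrite expansion_cat. Qed.

Lemma expansion_powS a d : expansion_pow a d.+1 = iter d expansion (iota 1 a).
Proof. by rewrite /expansion_pow iterSr /expansion /= cats0. Qed.

Lemma expansion_pow0 d : expansion_pow 0 d.+1 = [::].
Proof. by rewrite expansion_powS; elim: d => //= d ->. Qed.

(** [iota 1 a.+1] is [iota 1 a] followed by [a.+1], and iterated expansion distributes over
    concatenation. *)
Lemma expansion_powSS a d :
  expansion_pow a.+1 d.+1 = expansion_pow a d.+1 ++ expansion_pow a.+1 d.
Proof.
by rewrite !expansion_powS -[a.+1]addn1 iotaD add1n iter_expansion_cat addn1.
Qed.

Lemma size_expansion_pow a d : size (expansion_pow a.+1 d) = 'C(a + d, d).
Proof.
elim: d a => [|d IHd] a; first by rewrite bin0.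
elim: a => [|a IHa].
  by rewrite expansion_powSS expansion_pow0 IHd !binn.
by rewrite expansion_powSS size_cat IHa IHd -addSnnS [in RHS]addnS binS.
Qed.

Lemma sumn_expansion_pow a d :
  sumn (expansion_pow a.+1 d) = 'C((a + d).+1, d.+1).
Proof. by rewrite -size_expansion -addnS -size_expansion_pow. Qed.

(** The exponent is positive because [[:: a]] is not a prefix of [[:: b]] when [a < b]. *)
Lemma prefix_expansion_pow a b d :
  a <= b -> prefix (expansion_pow a d.+1) (expansion_pow b d.+1).
Proof.
move/subnKC <-; elim: (b - a) => [|c IHc]; first by rewrite addn0 prefix_refl.
by rewrite addnS expansion_powSS; exact: prefix_trans IHc (prefix_prefix _ _).
Qed.

Lemma take_prefix (s t : seq nat) h :
  prefix s t -> h <= size s -> take h s = take h t.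
Proof. by case/prefixP=> u -> le_h; rewrite takel_cat. Qed.

Lemma take_expansion_pow a b d h :
    h <= size (expansion_pow a d.+1) -> h <= size (expansion_pow b d.+1) ->
  take h (expansion_pow a d.+1) = take h (expansion_pow b d.+1).
Proof.
by case/orP: (leq_total a b) => /(prefix_expansion_pow _ _ d) pre ha hb;
  [|symmetry]; apply: take_prefix.
Qed.

Lemma binomial_expansion_head_ge h i x m :
  binomial_expansion h i (x :: m) -> i <= x.
Proof.
elim: m h i x => [|y m IHm] h [|i] x //.
  by rewrite binomial_expansion1 => /and3P[].
by rewrite binomial_expansion_cons => /and3P[lt_yx _ /IHm]; lia.
Qed.

(** The base [a] stays general, since the induction passes to a base dictated by [x]. *)
Lemma sumn_take_expansion_pow m h i a :
    binomial_expansion h i m -> h <= size (expansion_pow a i) ->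
  sumn (take h (expansion_pow a i)) =
    \sum_(k < size m) 'C((nth 0 m k).+1, (i - k).+1).
Proof.
elim: m h i a => [|x m IHm] h [|i] a // Em le_ha.
have /andP[le_bh lt_hb] := binomial_expansion_lt Em.
have /subnK := binomial_expansion_head_ge _ _ _ _ Em.
move: (x - i.+1) => c def_x; rewrite -def_x in le_bh lt_hb.
(* With [x = c + i.+1], [c.+2] is the least base whose power has more than [h] entries: that power
   has ['C(x.+1, i.+1)] of them, and its first block ['C(x, i.+1)]. *)
rewrite (take_expansion_pow a c.+2) //; last first.
  by rewrite size_expansion_pow addSn ltnW.
rewrite expansion_powSS take_cat size_expansion_pow ifN -?leqNgt //.
rewrite sumn_cat sumn_expansion_pow big_ord_recl /= subn0 -def_x; congr addn.
under eq_bigr => k _ do rewrite /bump /= add1n subSS.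
(* If [x] is the last term, the cut falls exactly at the end of the first block. *)
case: m => [|y m] in IHm Em *.
  move: Em; rewrite binomial_expansion1 -def_x => /and3P[_ _ /eqP->].
  by rewrite subnn take0 big_ord0.
move: Em; rewrite binomial_expansion_cons -def_x => /and3P[_ _ Em].
apply: IHm Em _; rewrite size_expansion_pow.
by move: lt_hb; rewrite binS addSnnS; lia.
Qed.

Lemma size_expansion_truncation n i t : 0 < i ->
  prefix t (expansion_pow n i) -> size (expansion t) = macaulay_pow (size t) i.
Proof.
move=> i_gt0 pre_t; rewrite size_expansion.
have [t0 | t_gt0] := posnP (size t); first by rewrite (size0nil t0).
have [m Em] := binomial_expansion_exists t_gt0 i_gt0.
rewrite (macaulay_powE Em) -(sumn_take_expansion_pow _ _ _ n Em) ?size_prefix //.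
by move: pre_t; rewrite prefixE => /eqP->.
Qed.

(** Applied inside [expansion_pow n i.+1], this turns the truncation condition into a bound on
    lengths. *)
Lemma prefix_comparable (s t u : seq nat) :
  prefix s u -> prefix t u -> prefix s t = (size s <= size t).
Proof.
move=> pre_s pre_t; apply/idP/idP => [/size_prefix // | le_st].
by rewrite prefixE (take_prefix t u) // -prefixE.
Qed.

Theorem theorem2p14 (n : nat) (n_gt0 : 0 < n) (T : nat -> seq nat)
    (T_trunc : forall d : nat, truncation (T d) (expansion_pow n d)) :
  coherent_fractal_growth n T <-> O_sequence (fun d => size (T d)).
Proof.
have preT d: prefix (T d) (expansion_pow n d) by apply/truncationP.
have step i: 0 < i ->
    truncation (T i.+1) (expansion (T i)) <->
      size (T i.+1) <= macaulay_pow (size (T i)) i.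
  move=> i_gt0; rewrite -(size_expansion_truncation n) //.
  rewrite -(prefix_comparable _ _ (expansion_pow n i.+1)) //.
    exact: truncationP.
  exact: prefix_expansion (preT i).
split=> [[T0 cohT] | [T0 OT]].
  by split=> [|i i_gt0]; [rewrite T0 | apply/step => //; apply: (cohT i.+1)].
have {}T0: T 0 = [:: n].
  by move: (preT 0); rewrite prefixE T0 => /eqP.
split=> // -[|[|i]] // _; last by apply/step => //; apply: OT.
(* An O-sequence has no bound on its entry at 1, but the expansion of [T 0] is all of
   [expansion_pow n 1]. *)
by apply/truncationP; rewrite /= T0; apply: (preT 1).
Qed.
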